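(* Let $\Gamma$ be a finite graph, $U$ a topological group, $\mathcal{O}\le U$ an open subgroup and $\varphi\colon\mathcal{O}\hookrightarrow U$ a continuous open monomorphism with $\varphi(\mathcal{O})=\mathcal{O}$. Let $\mathcal{R}$ be any set of representatives of the right cosets of $\mathcal{O}$ in $U$ with $1\in\mathcal{R}$, and let $\mathcal{W}$ be the set of normal sequences. Then the map $$\mathcal{W}\to\mathcal{A}_\Gamma(\varphi),\qquad\sigma\mapsto g_\sigma$$ is a bijection.
   Context: All topological groups are Hausdorff; graphs are simplicial with non-empty vertex set. A continuous open monomorphism is an injective group homomorphism that is continuous and open. For $\Gamma=(S,E)$ finite, $A_\Gamma=\langle S\mid sts^{-1}t^{-1},\{s,t\}\in E\rangle$. Put $\mathcal{H}_S(\varphi)=(U*F(S))/\langle\langle t\omega t^{-1}\varphi(\omega)^{-1}\mid t\in S,\omega\in\mathcal{O}\rangle\rangle$, with the unique group topology making the canonical embedding $U\hookrightarrow\mathcal{H}_S(\varphi)$ continuous and open, and $\mathcal{A}_\Gamma(\varphi)=\mathcal{H}_S(\varphi)/\langle\langle sts^{-1}t^{-1}\mid\{s,t\}\in E\rangle\rangle$ with the quotient topology. The groups $U$ and $A_\Gamma$ embed canonically in $\mathcal{A}_\Gamma(\varphi)$ and are identified with their images. Normal sequences: $\mathcal{W}$ is the set of all sequences $\sigma=(u_0,a_1,u_1,\dots,a_n,u_n)$ with $n\ge0$, $u_0,\dots,u_n\in U$, $a_1,\dots,a_n\in A_\Gamma$ such that, whenever $n\ge1$: $u_i\in\mathcal{R}\setminus\{1\}$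 for $1\le i\le n-1$, $u_n\in\mathcal{R}$, and $a_1,\dots,a_n\in A_\Gamma\setminus\{1\}$ (no condition on $u_0\in U$). For such $\sigma$, $g_\sigma:=u_0a_1u_1\cdots a_nu_n\in\mathcal{A}_\Gamma(\varphi)$. Right cosets of $\mathcal{O}$ are the sets $\mathcal{O}u$, $u\in U$. *)

(* Defs.v *)
From HB Require Import structures.
From mathcomp Require Import all_boot.
From mathcomp Require Import generic_quotient boolp classical_sets functions.
From mathcomp Require Import topology.

Set Implicit Arguments.
Unset Strict Implicit.
Unset Printing Implicit Defensive.

Import Algebra.

Local Open Scope classical_set_scope.
Local Open Scope group_scope.
Local Open Scope quotient_scope.

HB.mixin Record isTopologicalGroup G & Topological G & Group G := {
  mulg_continuous : continuous (fun x : G * G => x.1 * x.2);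
  invg_continuous : continuous (fun x : G => x^-1)
}.

#[short(type="topologicalGroupType")]
HB.structure Definition TopologicalGroup :=
  {G of Topological G & Group G & isTopologicalGroup G}.

Section Subgroups.
Context {G : groupType}.
Implicit Types (A N O R : set G).

Definition subgroup A :=
  [/\ A 1, forall x y, A x -> A y -> A (x * y) & forall x, A x -> A x^-1].

Definition normal_subgroup N :=
  subgroup N /\ forall x y, N x -> N (x ^ y).

Definition normal_closure R : set G := smallest normal_subgroup R.

Definition right_coset O (u : G) : set G := [set w * u | w in O].

Definition right_coset_representatives O R :=
  forall u : G, exists! r : G, (R `&` right_coset O u) r.

Lemma normal_closureP R : normal_subgroup (normal_closure R).
Proof.
split; first split.
- by move=> N [[[]]].
- by move=> x y Nx Ny N NP; case: (NP) => -[[_ + _] _] _; apply; [exact: Nx|exact: Ny].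
- by move=> x Nx N NP; case: (NP) => -[[_ _ +] _] _; apply; exact: Nx.
- by move=> x y Nx N NP; case: (NP) => -[_ +] _; apply; exact: Nx.
Qed.

Lemma sub_normal_closure R : R `<=` normal_closure R.
Proof. by move=> x Rx N [_]; apply. Qed.

End Subgroups.

Section RelatorQuotient.
Context {G : groupType} (R : set G).

Definition relq_rel : rel G := fun x y => `[< normal_closure R (x^-1 * y) >].

Lemma relq_rel_equiv : equiv_class_of relq_rel.
Proof.
have [[N1 NM NV] _] := normal_closureP R.
split.
- by move=> x; apply/asboolP; rewrite mulVg.
- move=> x y; apply/asboolP/asboolP => /NV;
  by rewrite invgM invgK.
- move=> y x z /asboolP xy /asboolP yz; apply/asboolP.
  by have := NM _ _ xy yz; rewrite -mulgA mulVKg.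
Qed.

Canonical relq_equiv := EquivRelPack relq_rel_equiv.

Definition relq := {eq_quot relq_equiv}.

HB.instance Definition _ := Choice.on relq.
HB.instance Definition _ := EqQuotient.on relq.

Definition relq_proj (x : G) : relq := \pi_relq x.

Lemma relq_projE x y : relq_proj x = relq_proj y <-> normal_closure R (x^-1 * y).
Proof.
split; first by move/eqquotP/asboolP.
by move=> H; apply/eqquotP/asboolP.
Qed.

Lemma relq_reprK (x : relq) : relq_proj (repr x) = x.
Proof. exact: reprK. Qed.

Definition relq_one : relq := relq_proj 1.
Definition relq_inv (x : relq) : relq := relq_proj (repr x)^-1.
Definition relq_mul (x y : relq) : relq := relq_proj (repr x * repr y).

Lemma relq_projM x y : relq_proj (x * y) = relq_mul (relq_proj x) (relq_proj y).
Proof.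
have [[N1 NM NV] NJ] := normal_closureP R.
apply/esym/relq_projE.
set x' := repr _; set y' := repr _.
have hx : normal_closure R (x'^-1 * x) by apply/relq_projE; rewrite relq_reprK.
have hy : normal_closure R (y'^-1 * y) by apply/relq_projE; rewrite relq_reprK.
have := NM _ _ (NJ _ y' hx) hy.
by rewrite conjgE invgM -!mulgA mulVKg.
Qed.

Lemma relq_projV x : relq_proj x^-1 = relq_inv (relq_proj x).
Proof.
have [[N1 NM NV] NJ] := normal_closureP R.
apply/relq_projE.
set x' := repr _.
have hx : normal_closure R (x'^-1 * x) by apply/relq_projE; rewrite relq_reprK.
have := NJ _ x'^-1 hx.
by rewrite conjgE -!mulgA mulKg invgK.
Qed.

Lemma relq_mulA : associative relq_mul.
Proof.
move=> x y z; rewrite -(relq_reprK x) -(relq_reprK y) -(relq_reprK z).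
by rewrite -!relq_projM mulgA.
Qed.

Lemma relq_mul1 : left_id relq_one relq_mul.
Proof. by move=> x; rewrite -(relq_reprK x) -relq_projM mul1g. Qed.

Lemma relq_mulr1 : right_id relq_one relq_mul.
Proof. by move=> x; rewrite -(relq_reprK x) -relq_projM mulg1. Qed.

Lemma relq_mulV : left_inverse relq_one relq_inv relq_mul.
Proof. by move=> x; rewrite -(relq_reprK x) -relq_projV -relq_projM mulVg. Qed.

Lemma relq_mulrV : right_inverse relq_one relq_inv relq_mul.
Proof. by move=> x; rewrite -(relq_reprK x) -relq_projV -relq_projM mulgV. Qed.

HB.instance Definition _ := isGroup.Build relq
  relq_mulA relq_mul1 relq_mulr1 relq_mulV relq_mulrV.

Lemma relq_proj_morphism : monoid_morphism relq_proj.
Proof. by split=> // x y; exact: relq_projM. Qed.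

HB.instance Definition _ := isUMagmaMorphism.Build G relq relq_proj
  relq_proj_morphism.

Lemma relq_relator r : R r -> relq_proj r = 1.
Proof.
move=> Rr; rewrite -[RHS]/(relq_proj 1); apply/esym/relq_projE.
by rewrite invg1 mul1g; exact: sub_normal_closure.
Qed.

End RelatorQuotient.

Arguments relq {G} R.
Arguments relq_proj {G} R x.

Section FreeGroup.
Context {X : choiceType}.

(** The letter [(true, x)] stands for [x] and [(false, x)] for its inverse. *)
Inductive fg_eqv : seq (bool * X) -> seq (bool * X) -> Prop :=
| fg_eqv_refl w : fg_eqv w w
| fg_eqv_sym v w : fg_eqv v w -> fg_eqv w v
| fg_eqv_trans u v w : fg_eqv u v -> fg_eqv v w -> fg_eqv u w
| fg_eqv_cancel v w b x : fg_eqv (v ++ [:: (b, x), (~~ b, x) & w]) (v ++ w).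

Definition fg_rel : rel (seq (bool * X)) := fun v w => `[< fg_eqv v w >].

Lemma fg_rel_equiv : equiv_class_of fg_rel.
Proof.
split.
- by move=> w; apply/asboolP; exact: fg_eqv_refl.
- by move=> v w; apply/asboolP/asboolP; exact: fg_eqv_sym.
- by move=> v u w /asboolP uv /asboolP vw; apply/asboolP; exact: fg_eqv_trans uv vw.
Qed.

Canonical fg_equiv := EquivRelPack fg_rel_equiv.

End FreeGroup.

Definition free_group (X : choiceType) := {eq_quot (@fg_equiv X)}.

Section FreeGroupTheory.
Context {X : choiceType}.
Implicit Types (u v w : seq (bool * X)).

HB.instance Definition _ := Choice.on (free_group X).
HB.instance Definition _ := EqQuotient.on (free_group X).

Definition fg_word w : free_group X := \pi_(free_group X) w.

Definition fg_gen (x : X) : free_group X := fg_word [:: (true, x)].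

Definition inv_word w := rev [seq (~~ p.1, p.2) | p <- w].

Definition fg_one : free_group X := fg_word [::].
Definition fg_mul (x y : free_group X) := fg_word (repr x ++ repr y).
Definition fg_inv (x : free_group X) := fg_word (inv_word (repr x)).

Lemma fg_wordE v w : fg_word v = fg_word w <-> fg_eqv v w.
Proof.
split; first by move/eqquotP/asboolP.
by move=> H; apply/eqquotP/asboolP.
Qed.

Lemma fg_reprK (x : free_group X) : fg_word (repr x) = x.
Proof. exact: reprK. Qed.

Lemma fg_eqv_cat2l u v w : fg_eqv v w -> fg_eqv (u ++ v) (u ++ w).
Proof.
elim=> {v w} [w|v w _|v1 v2 v3 _ + _|v w b x].
- exact: fg_eqv_refl.
- exact: fg_eqv_sym.
- exact: fg_eqv_trans.
- by rewrite !catA; exact: fg_eqv_cancel.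
Qed.

Lemma fg_eqv_cat2r u v w : fg_eqv v w -> fg_eqv (v ++ u) (w ++ u).
Proof.
elim=> {v w} [w|v w _|v1 v2 v3 _ + _|v w b x].
- exact: fg_eqv_refl.
- exact: fg_eqv_sym.
- exact: fg_eqv_trans.
- by rewrite -!catA; exact: fg_eqv_cancel.
Qed.

Lemma fg_eqv_inv v w : fg_eqv v w -> fg_eqv (inv_word v) (inv_word w).
Proof.
elim=> {v w} [w|v w _|v1 v2 v3 _ + _|v w b x].
- exact: fg_eqv_refl.
- exact: fg_eqv_sym.
- exact: fg_eqv_trans.
- rewrite /inv_word !map_cat !rev_cat /= !rev_cons -!cats1 -!catA /= negbK.
  exact: fg_eqv_cancel.
Qed.

Lemma fg_word_cat v w : fg_word (v ++ w) = fg_mul (fg_word v) (fg_word w).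
Proof.
apply/fg_wordE/(@fg_eqv_trans _ _ (repr (fg_word v) ++ w)).
- by apply/fg_eqv_cat2r/fg_wordE; rewrite fg_reprK.
- by apply/fg_eqv_cat2l/fg_wordE; rewrite fg_reprK.
Qed.

Lemma fg_word_inv w : fg_word (inv_word w) = fg_inv (fg_word w).
Proof. by apply/fg_wordE/fg_eqv_inv/fg_wordE; rewrite fg_reprK. Qed.

Lemma inv_wordK : involutive inv_word.
Proof.
move=> w; rewrite /inv_word map_rev revK -map_comp map_id_in// => -[b x] _ /=.
by rewrite negbK.
Qed.

Lemma fg_eqv_catV w : fg_eqv (w ++ inv_word w) [::].
Proof.
elim/last_ind: w => [|w [b x] IHw]; first exact: fg_eqv_refl.
rewrite /inv_word map_rcons rev_rcons /= -cats1 -catA /=.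
exact: fg_eqv_trans (fg_eqv_cancel _ _ _ _) IHw.
Qed.

Lemma fg_mulA : associative fg_mul.
Proof.
move=> x y z; rewrite -(fg_reprK x) -(fg_reprK y) -(fg_reprK z).
by rewrite -!fg_word_cat catA.
Qed.

Lemma fg_mul1 : left_id fg_one fg_mul.
Proof. by move=> x; rewrite -(fg_reprK x) -fg_word_cat. Qed.

Lemma fg_mulr1 : right_id fg_one fg_mul.
Proof. by move=> x; rewrite -(fg_reprK x) -fg_word_cat cats0. Qed.

Lemma fg_mulrV : right_inverse fg_one fg_inv fg_mul.
Proof.
move=> x; rewrite -(fg_reprK x) -fg_word_inv -fg_word_cat.
exact/fg_wordE/fg_eqv_catV.
Qed.

Lemma fg_mulV : left_inverse fg_one fg_inv fg_mul.
Proof.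
move=> x; rewrite -(fg_reprK x) -fg_word_inv -fg_word_cat.
by apply/fg_wordE; rewrite -[X in _ ++ X]inv_wordK; exact: fg_eqv_catV.
Qed.

HB.instance Definition _ := isGroup.Build (free_group X)
  fg_mulA fg_mul1 fg_mulr1 fg_mulV fg_mulrV.

End FreeGroupTheory.

(** [G * H] is presented by the elements of [G] and [H] as generators, subject
    to the multiplication tables of [G] and [H]. *)
Section FreeProduct.
Context (G H : groupType).

Definition fprod_relators : set (free_group (G + H)%type) :=
  [set fg_gen (inl x) * fg_gen (inl y) * (fg_gen (inl (x * y)))^-1
     | x in setT & y in setT] `|`
  [set fg_gen (inr x) * fg_gen (inr y) * (fg_gen (inr (x * y)))^-1
     | x in setT & y in setT].

Definition fprod := relq fprod_relators.

HB.instance Definition _ := Group.on fprod.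

Definition fprodl (x : G) : fprod := relq_proj fprod_relators (fg_gen (inl x)).
Definition fprodr (y : H) : fprod := relq_proj fprod_relators (fg_gen (inr y)).

Lemma fprodl_morphism : monoid_morphism fprodl.
Proof.
have M : {morph fprodl : x y / x * y}.
  move=> x y; apply/esym/divg1_eq.
  have : relq_proj fprod_relators
      (fg_gen (inl x) * fg_gen (inl y) * (fg_gen (inl (x * y)))^-1) = 1.
    by apply: relq_relator; left; exists x => //; exists y.
  by rewrite !gmulfM gmulfV.
by split=> //; apply: (@mulgI _ (fprodl 1)); rewrite -M !mulg1.
Qed.

Lemma fprodr_morphism : monoid_morphism fprodr.
Proof.
have M : {morph fprodr : x y / x * y}.
  move=> x y; apply/esym/divg1_eq.
  have : relq_proj fprod_relators
      (fg_gen (inr x) * fg_gen (inr y) * (fg_gen (inr (x * y)))^-1) = 1.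
    by apply: relq_relator; right; exists x => //; exists y.
  by rewrite !gmulfM gmulfV.
by split=> //; apply: (@mulgI _ (fprodr 1)); rewrite -M !mulg1.
Qed.

HB.instance Definition _ := isUMagmaMorphism.Build G fprod fprodl fprodl_morphism.
HB.instance Definition _ := isUMagmaMorphism.Build H fprod fprodr fprodr_morphism.

End FreeProduct.

Arguments fprodl {G H} x.
Arguments fprodr {G H} y.

Definition simple_graph (S : finType) (E : rel S) := symmetric E /\ irreflexive E.

Section RAAG.
Context {S : finType} (E : rel S).

Definition raag_relators : set (free_group S) :=
  [set r | exists2 st : S * S, E st.1 st.2 &
     r = fg_gen st.1 * fg_gen st.2 * (fg_gen st.1)^-1 * (fg_gen st.2)^-1].

Definition raag := relq raag_relators.

HB.instance Definition _ := Group.on raag.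

End RAAG.

(** [phi] is a total function on [U] of which only the restriction to [O]
    matters. *)
Definition continuous_open_monomorphism (U : topologicalGroupType) (O : set U)
    (phi : U -> U) :=
  [/\ {in O &, {morph phi : x y / x * y}},
      set_inj O phi,
      {within O, continuous phi} &
      forall V : set U, open V -> open (phi @` (O `&` V))].

Section HNN.
Context {U : groupType} (S : finType) (O : set U) (phi : U -> U).

Definition hnn_relators : set (fprod U (free_group S)) :=
  [set fprodr (fg_gen t) * fprodl w * (fprodr (fg_gen t))^-1 * (fprodl (phi w))^-1
     | t in setT & w in O].

Definition hnn := relq hnn_relators.

HB.instance Definition _ := Group.on hnn.

Definition hnn_base (u : U) : hnn := relq_proj hnn_relators (fprodl u).
Definition hnn_free (x : free_group S) : hnn := relq_proj hnn_relators (fprodr x).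

HB.instance Definition _ := UMagmaMorphism.copy hnn_base
  (relq_proj hnn_relators \o fprodl).
HB.instance Definition _ := UMagmaMorphism.copy hnn_free
  (relq_proj hnn_relators \o fprodr).

End HNN.

(** Only the group underlying the topological group [A_Gamma(phi)]: its topology is
    not needed. *)
Section HNNRAAG.
Context {U : groupType} {S : finType} (E : rel S) (O : set U) (phi : U -> U).

Definition hraag_relators : set (hnn S O phi) :=
  [set r | exists2 st : S * S, E st.1 st.2 &
     let s := hnn_free O phi (fg_gen st.1) in
     let t := hnn_free O phi (fg_gen st.2) in
     r = s * t * s^-1 * t^-1].

Definition hraag := relq hraag_relators.

HB.instance Definition _ := Group.on hraag.

Definition hraag_base (u : U) : hraag :=
  relq_proj hraag_relators (hnn_base S O phi u).

Definition hraag_free (x : free_group S) : hraag :=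
  relq_proj hraag_relators (hnn_free O phi x).

HB.instance Definition _ := UMagmaMorphism.copy hraag_base
  (relq_proj hraag_relators \o hnn_base S O phi).
HB.instance Definition _ := UMagmaMorphism.copy hraag_free
  (relq_proj hraag_relators \o hnn_free O phi).

(** The homomorphism induced by [hraag_free]; it does not depend on the choice
    of the representative, see [hraag_raagE]. *)
Definition hraag_raag (a : raag E) : hraag := hraag_free (repr a).

Lemma hraag_raagE x : hraag_raag (relq_proj (raag_relators E) x) = hraag_free x.
Proof.
suff sub : normal_closure (raag_relators E) `<=` [set y | hraag_free y = 1].
  rewrite /hraag_raag; set x' := repr _.
  have /sub /= : normal_closure (raag_relators E) (x'^-1 * x).
    by apply/relq_projE; rewrite relq_reprK.
  by rewrite gmulfM gmulfV => /mulg1_eq <-; rewrite invgK.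
apply: smallest_sub => /=.
  split; first split => /=.
  - exact: gmulf1.
  - by move=> y z hy hz; rewrite gmulfM /= hy hz mulg1.
  - by move=> y hy; rewrite gmulfV /= hy invg1.
  - by move=> y z hy; rewrite /= conjgE !gmulfM gmulfV /= hy mul1g mulVg.
move=> _ [[s t] Est ->] /=; rewrite !gmulfM !gmulfV.
have : relq_proj hraag_relators
    (hnn_free O phi (fg_gen s) * hnn_free O phi (fg_gen t) *
     (hnn_free O phi (fg_gen s))^-1 * (hnn_free O phi (fg_gen t))^-1) = 1.
  by apply: relq_relator; exists (s, t).
by rewrite !gmulfM !gmulfV.
Qed.

Lemma hraag_raag_morphism : monoid_morphism hraag_raag.
Proof.
split=> [|a b]; first by rewrite -[LHS]/(hraag_raag (relq_proj _ 1)) hraag_raagE gmulf1.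
by rewrite -(relq_reprK a) -(relq_reprK b) -gmulfM !hraag_raagE gmulfM.
Qed.

HB.instance Definition _ := isUMagmaMorphism.Build (raag E) hraag hraag_raag
  hraag_raag_morphism.

(** The sequence [(u_0, a_1, u_1, ..., a_n, u_n)] is encoded as the pair of
    [u_0] and the list of the pairs [(a_1, u_1), ..., (a_n, u_n)]. *)
Definition normal_sequences (R : set U) : set (U * seq (raag E * U)) :=
  [set sigma | forall i, (i < size sigma.2)%N ->
     let: (a, u) := nth (1, 1) sigma.2 i in
     [/\ a <> 1, R u & (i.+1 < size sigma.2)%N -> u <> 1]].

Definition sequence_value (sigma : U * seq (raag E * U)) : hraag :=
  hraag_base sigma.1 *
  \big[*%g/1]_(p <- sigma.2) (hraag_raag p.1 * hraag_base p.2).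

End HNNRAAG.

Arguments normal_sequences {U S} E R.
Arguments sequence_value {U S} E O phi sigma.

(* Main.v *)
Require Import Defs.
From HB Require Import structures.
From mathcomp Require Import all_boot.
From mathcomp Require Import boolp classical_sets functions topology.

(* Van der Waerden's trick.  Since [phi] restricts to an automorphism of [O],
   mapping every generator to [phi] defines an action [alpha] of [A_Gamma] on [O]
   such that [a w = alpha a w * a] in [A_Gamma(phi)] for [w] in [O].  The groups
   [U] and [A_Gamma] act on the set of normal sequences by the rules for left
   multiplication of normal forms, and these actions satisfy the defining
   relations, so [A_Gamma(phi)] acts on normal sequences.  The map
   [x |-> x . (1)] is the inverse of [sigma |-> g_sigma]. *)

Set Implicit Arguments.
Unset Strict Implicit.
Unset Printing Implicit Defensive.

Local Open Scope classical_set_scope.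

(** * Homomorphisms on quotients by relators *)

Section Morphisms.
Local Open Scope group_scope.
Context {G K : groupType} {f : G -> K}.
Hypothesis fM : {morph f : x y / x * y}.

Lemma morph_one : f 1 = 1.
Proof. by apply: (@mulgI _ (f 1)); rewrite -fM !mulg1. Qed.

Lemma morph_inv x : f x^-1 = (f x)^-1.
Proof. by apply/esym/mulg1_eq; rewrite -fM mulgV morph_one. Qed.

Lemma subgroup_preimage (A : set K) : subgroup A -> subgroup (f @^-1` A).
Proof.
case=> A1 AM AV; split=> [|x y|x] /=; rewrite ?morph_one ?fM ?morph_inv //.
- exact: AM.
- exact: AV.
Qed.

Lemma normal_subgroup_ker : normal_subgroup [set x | f x = 1].
Proof.
split; first split=> [|x y|x] /=; rewrite ?morph_one ?fM ?morph_inv //.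
- by move=> -> ->; rewrite mulg1.
- by move=> ->; rewrite invg1.
- by move=> x y /= fx; rewrite conjgE !fM fx mul1g morph_inv mulVg.
Qed.

(** The kernel of [f] is a normal subgroup containing [R], hence contains the normal closure; so [f]
    does not see the choice of [repr], and [f \o repr] is the induced map. *)
Lemma relq_lift (R : set G) : (forall r, R r -> f r = 1) ->
  exists2 g : relq R -> K, {morph g : x y / x * y} &
    forall x, g (relq_proj R x) = f x.
Proof.
move=> fR; have fE x : f (repr (relq_proj R x)) = f x.
  have /(smallest_sub normal_subgroup_ker fR) /= :
      normal_closure R ((repr (relq_proj R x))^-1 * x).
    by apply/relq_projE; rewrite relq_reprK.
  by rewrite fM morph_inv => /mulg1_eq <-; rewrite invgK.
exists (f \o repr) => //= x y.
by rewrite -fM -[RHS]fE gmulfM /= !relq_reprK.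
Qed.

End Morphisms.

(** * Generation and universal properties of free groups and free products *)

Section Generation.
Local Open Scope group_scope.

Lemma relq_gen {G : groupType} {R : set G} {A : set (relq R)} :
  (forall x, A (relq_proj R x)) -> forall x, A x.
Proof. by move=> AG x; rewrite -(relq_reprK x). Qed.

Lemma free_group_gen {X : choiceType} {A : set (free_group X)} :
  subgroup A -> (forall x, A (fg_gen x)) -> forall x, A x.
Proof.
move=> [A1 AM AV] AX x; rewrite -(fg_reprK x).
elim: (repr x) => [//|[b t] w IHw]; rewrite -cat1s fg_word_cat.
apply: (AM (fg_word _) (fg_word _)) => //.
case: b; first exact: AX.
have -> : fg_word [:: (false, t)] = (fg_gen t)^-1 by exact: (fg_word_inv [:: (true, t)]).
exact: AV.
Qed.

(* Unqualified, [fprod] would be the one of [finfun]. *)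
Lemma fprod_gen {G H : groupType} {A : set (Defs.fprod G H)} : subgroup A ->
  (forall x, A (fprodl x)) -> (forall y, A (fprodr y)) -> forall z, A z.
Proof.
move=> sA Al Ar; apply: relq_gen.
have projM : {morph relq_proj (@fprod_relators G H) : x y / x * y} by exact: gmulfM.
have sPA := @subgroup_preimage _ (Defs.fprod G H) _ projM A sA.
by apply: (free_group_gen sPA); case.
Qed.

(** Evaluation of words letter by letter is invariant under [fg_eqv], because a cancelling pair
    evaluates to 1. *)
Lemma free_group_lift {X : choiceType} {K : groupType} (f : X -> K) :
  exists2 g : free_group X -> K, {morph g : x y / x * y} &
    forall x, g (fg_gen x) = f x.
Proof.
pose letter (p : bool * X) := if p.1 then f p.2 else (f p.2)^-1.
pose ev w := \prod_(p <- w) letter p.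
have evE v w : fg_eqv v w -> ev v = ev w.
  elim=> {v w} [//|//|u v w _ -> _ //|v w b x].
  rewrite /ev !big_cat !big_cons /= /letter /=; congr (_ * _).
  by case: b => /=; rewrite ?mulVKg ?mulKg.
have evr w : ev (repr (fg_word w)) = ev w by apply/evE/fg_wordE/fg_reprK.
exists (fun x => ev (repr x)) => [x y|x].
  by rewrite -[x * y]/(fg_word (repr x ++ repr y)) evr /ev big_cat.
by rewrite evr /ev big_seq1.
Qed.

Lemma fprod_lift {G H K : groupType} (f : G -> K) (g : H -> K) :
  {morph f : x y / x * y} -> {morph g : x y / x * y} ->
  exists h : Defs.fprod G H -> K, [/\ {morph h : x y / x * y},
    forall x, h (fprodl x) = f x & forall y, h (fprodr y) = g y].
Proof.
move=> fM gM.
have [h hM hE] := free_group_lift (fun z : G + H =>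
  match z with inl x => f x | inr y => g y end).
have [] := @relq_lift _ _ h hM (@fprod_relators G H).
  by move=> _ [] [x _ [y _ <-]]; rewrite !hM (morph_inv hM) !hE ?fM ?gM mulgV.
move=> k kM kE; exists k; split=> // z.
- by rewrite kE hE.
- by rewrite kE hE.
Qed.

End Generation.

(** * The group of bijections of a type, as target for group actions *)

Record bijection (X : Type) := Bijection {
  bij_fun : X -> X;
  bij_inv : X -> X;
  bij_funK : cancel bij_fun bij_inv;
  bij_invK : cancel bij_inv bij_fun
}.

Section BijectionGroup.
Context {X : Type}.
Implicit Types p q r : bijection X.

Lemma bijection_eq p q : bij_fun p =1 bij_fun q -> p = q.
Proof.
case: p q => [f f' fK f'K] [g g' gK g'K] /= /funext fg.
have f'g' : f' = g' by apply/funext => x; rewrite -[x in LHS]g'K -fg fK.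
move: fK f'K gK g'K; rewrite fg f'g' => ? ? ? ?.
by congr Bijection; exact: Prop_irrelevance.
Qed.

HB.instance Definition _ := gen_eqMixin (bijection X).
HB.instance Definition _ := gen_choiceMixin (bijection X).

Definition bijection_one := @Bijection X id id (fun=> erefl) (fun=> erefl).
Definition bijection_mul p q :=
  Bijection (can_comp (bij_funK p) (bij_funK q))
            (can_comp (bij_invK q) (bij_invK p)).
Definition bijection_inv p := Bijection (bij_invK p) (bij_funK p).

Lemma bijection_mulA : associative bijection_mul.
Proof. by move=> p q r; exact: bijection_eq. Qed.
Lemma bijection_mul1 : left_id bijection_one bijection_mul.
Proof. by move=> p; exact: bijection_eq. Qed.
Lemma bijection_mulr1 : right_id bijection_one bijection_mul.
Proof. by move=> p; exact: bijection_eq. Qed.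
Lemma bijection_mulV : left_inverse bijection_one bijection_inv bijection_mul.
Proof. by move=> p; apply: bijection_eq => x; exact: bij_funK. Qed.
Lemma bijection_mulrV : right_inverse bijection_one bijection_inv bijection_mul.
Proof. by move=> p; apply: bijection_eq => x; exact: bij_invK. Qed.

HB.instance Definition _ := isGroup.Build (bijection X)
  bijection_mulA bijection_mul1 bijection_mulr1 bijection_mulV bijection_mulrV.

End BijectionGroup.

Lemma action_morphism {G : groupType} {X : Type} (act : G -> X -> X) :
  act 1%g =1 id -> (forall a b x, act (a * b)%g x = act a (act b x)) ->
  exists2 f : G -> bijection X, {morph f : a b / (a * b)%g} &
    forall a x, bij_fun (f a) x = act a x.
Proof.
move=> act1 actM.
have actK a : cancel (act a) (act a^-1%g).
  by move=> x; rewrite -actM mulVg act1.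
have actVK a : cancel (act a^-1%g) (act a).
  by move=> x; rewrite -actM mulgV act1.
exists (fun a => Bijection (actK a) (actVK a)) => // a b.
by apply: bijection_eq => x /=; exact: actM.
Qed.

(** * Generation and universal properties of [raag] and [hraag] *)

Section Presentations.
Local Open Scope group_scope.
Context {S : finType} (E : rel S).

Lemma raag_gen {A : set (raag E)} : subgroup A ->
  (forall s, A (relq_proj _ (fg_gen s))) -> forall a, A a.
Proof.
move=> sA As; apply: relq_gen.
have projM : {morph relq_proj (raag_relators E) : x y / x * y} by exact: gmulfM.
exact: (free_group_gen (@subgroup_preimage _ (raag E) _ projM A sA)).
Qed.

Lemma raag_lift {K : groupType} (f : S -> K) :
  (forall s t, E s t -> f s * f t = f t * f s) ->
  exists2 g : raag E -> K, {morph g : x y / x * y} &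
    forall s, g (relq_proj _ (fg_gen s)) = f s.
Proof.
move=> fC; have [g gM gE] := free_group_lift f.
have [|h hM hE] := @relq_lift _ _ g gM (raag_relators E).
  move=> _ [[s t] /= Est ->].
  by rewrite !gM !(morph_inv gM) !gE fC // mulgK mulgV.
by exists h => // s; rewrite hE gE.
Qed.

Context {U : groupType} (O : set U) (phi : U -> U).

Lemma hraag_gen {A : set (hraag E O phi)} : subgroup A ->
  (forall u, A (hraag_base E O phi u)) ->
  (forall a, A (hraag_raag O phi a)) -> forall x, A x.
Proof.
move=> sA Ab Ar; do 2! apply: relq_gen.
have projM : {morph relq_proj (@hraag_relators U S E O phi) \o
    relq_proj (@hnn_relators U S O phi) : x y / x * y} by exact: gmulfM.
apply: (fprod_gen (@subgroup_preimage _ (hraag E O phi) _ projM A sA)) => // y.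
by have := Ar (relq_proj _ y); rewrite hraag_raagE.
Qed.

(** The map is built through the free product, then [hnn], then [hraag]. The hypothesis on [f] and
    [g] kills the conjugation relators; the commutators die because [g] is already defined on
    [raag E]. *)
Lemma hraag_lift {K : groupType} (f : U -> K) (g : raag E -> K) :
  {morph f : x y / x * y} -> {morph g : x y / x * y} ->
  (forall s w, O w -> g (relq_proj _ (fg_gen s)) * f w =
                      f (phi w) * g (relq_proj _ (fg_gen s))) ->
  exists h : hraag E O phi -> K, [/\ {morph h : x y / x * y},
    forall u, h (hraag_base E O phi u) = f u &
    forall a, h (hraag_raag O phi a) = g a].
Proof.
move=> fM gM fg.
pose g' := g \o relq_proj (raag_relators E).
have g'M : {morph g' : x y / x * y} by move=> x y; rewrite /g' /= gmulfM gM.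
have [k [kM kl kr]] := fprod_lift fM g'M.
have [|k1 k1M k1E] := @relq_lift _ _ k kM (@hnn_relators U S O phi).
  move=> _ [t _ [w Ow <-]].
  by rewrite !kM !(morph_inv kM) !kr !kl /g' /= fg // mulgK mulgV.
have [|k2 k2M k2E] := @relq_lift _ _ k1 k1M (@hraag_relators U S E O phi).
  move=> _ [[s t] /= Est ->].
  rewrite !k1M !(morph_inv k1M) !k1E !kr -!(morph_inv g'M) -!g'M /g' /=.
  by rewrite relq_relator ?(morph_one gM) //; exists (s, t).
exists k2; split=> // [u|]; first by rewrite k2E k1E kl.
by apply: relq_gen => x; rewrite hraag_raagE k2E k1E kr.
Qed.

End Presentations.

(** * The action of [raag E] on [O] through [phi] *)

Section Twisting.
Local Open Scope group_scope.
Context {S : finType} (E : rel S) {U : groupType} (O : set U) (phi : U -> U).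
Hypotheses (sO : subgroup O) (phiM : {in O &, {morph phi : x y / x * y}}).
Hypotheses (phi_inj : set_inj O phi) (phiO : phi @` O = O).

(** Extending [phi] by the identity outside [O] gives a permutation of all of [U], so that
    [raag_lift] applies with target [bijection U]. *)
Lemma bijection_extension : exists p : bijection U,
  (forall w, O w -> bij_fun p w = phi w) /\ (forall w, O (bij_fun p w) <-> O w).
Proof.
pose f w := if `[< O w >] then phi w else w.
have phiOw w : O w -> O (phi w) by move=> Ow; rewrite -phiO; exists w.
have fO w : O w -> f w = phi w by rewrite /f => /asboolT ->.
have fN w : ~ O w -> f w = w by rewrite /f => /asboolF ->.
have fOP w : O (f w) <-> O w.
  by split=> Ow; last (by rewrite fO//; exact: phiOw); apply: contrapT => /[dup] /fN <-.
have /choice [g gK] : forall y, exists x, f x = y.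
  move=> y; have [|/fN fy] := pselect (O y); last by exists y.
  by rewrite -{1}phiO => -[x Ox <-]; exists x; rewrite fO.
have f_inj : injective f.
  move=> x y fxy; have [Ox|Nx] := pselect (O x).
    have Oy : O y by apply/fOP; rewrite -fxy; apply/fOP.
    by move: fxy; rewrite !fO // => /phi_inj; apply; exact/mem_set.
  have Ny : ~ O y by move/fOP; rewrite -fxy => /fOP.
  by move: fxy; rewrite !fN.
have fK : cancel f g by move=> x; apply: f_inj; rewrite gK.
by exists (Bijection fK gK).
Qed.

Lemma twisting : exists alpha : raag E -> U -> U, [/\
  (alpha 1 =1 id) /\ (forall a b w, alpha (a * b) w = alpha a (alpha b w)),
  forall s w, O w -> alpha (relq_proj _ (fg_gen s)) w = phi w,
  forall a w, O w -> O (alpha a w) &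
  forall a v w, O v -> O w -> alpha a (v * w) = alpha a v * alpha a w].
Proof.
have [p [pE pO]] := bijection_extension.
(* All generators have the same image [p], so the commutation relations hold trivially. *)
have [//|f fM fE] := @raag_lift _ E (bijection U) (fun=> p).
(* The equivalence, rather than one implication, makes [good] closed under inverses. *)
pose good := [set q : bijection U | (forall w, O (bij_fun q w) <-> O w) /\
  (forall v w, O v -> O w -> bij_fun q (v * w) = bij_fun q v * bij_fun q w)].
have sgood : subgroup good.
  split.
  - by split.
  - move=> q r [qO qM] [rO rM]; split=> [w|v w Ov Ow] /=.
      by split=> [/qO/rO|/rO/qO].
    by rewrite rM // qM //; apply/rO.
  - move=> q [qO qM].
    have qVO w : O (bij_fun q^-1 w) <-> O w.
      by rewrite -[w in X in _ <-> X](bij_invK q); split=> /qO.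
    split=> // v w Ov Ow; apply: (can_inj (bij_funK q)).
    by rewrite [LHS]bij_invK qM ?qVO // ![bij_fun q _]bij_invK.
have fgood a : good (f a).
  move: a; apply: (raag_gen (subgroup_preimage fM sgood)) => s /=.
  rewrite fE; split=> // v w Ov Ow; rewrite !pE // ?phiM //; try exact/mem_set.
  by case: sO => _ + _; apply.
exists (fun a => bij_fun (f a)); split.
- by split=> [w|a b w]; rewrite ?(morph_one fM) ?fM.
- by move=> s w Ow; rewrite fE pE.
- by move=> a w; apply: ((fgood a).1 w).2.
- by move=> a; exact: (fgood a).2.
Qed.

End Twisting.

(** * Left multiplication on normal forms *)

Section NormalForms.
Local Open Scope group_scope.
Context {A U : groupType} (O R : set U).
Hypotheses (sO : subgroup O) (hR : right_coset_representatives O R) (R1 : R 1).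

(** Structural counterpart of the indexed condition in [normal_sequences], suited to splitting off
    the first pair; [normal_sequencesE] compares the two. *)
Fixpoint normal_tail (l : seq (A * U)) : Prop :=
  if l is (a, u) :: l' then
    [/\ a <> 1, R u, u = 1 -> l' = [::] & normal_tail l']
  else True.

Definition coset_rep (u : U) : U := xget 1 (R `&` right_coset O u).

Lemma coset_repP u : R (coset_rep u) /\ O (u * (coset_rep u)^-1).
Proof.
have [r [+ _]] := hR u; rewrite /coset_rep.
case: xgetP => [x _ [Rx [w Ow wx]] _|/(_ r)//].
by case: sO => _ _ OV; split=> //; rewrite -wx invgM mulVKg; exact: OV.
Qed.

Lemma coset_repM w u : O w -> R u -> coset_rep (w * u) = u.
Proof.
case: sO => _ _ OV Ow Ru; have [r [_ ru]] := hR (w * u).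
have uP : (R `&` right_coset O (w * u)) u.
  by split=> //; exists w^-1; [exact: OV|rewrite mulKg].
by rewrite /coset_rep; case: xgetP => [x _ /ru <-|/(_ u) //]; exact: ru.
Qed.

(* The normal sequence of [w b u] followed by [l], where [b] may be trivial. *)
Definition block (w : U) (b : A) (u : U) (l : seq (A * U)) :=
  if b == 1 then (w * u, l) else (w, (b, u) :: l).

(** Exactly what keeps [block w b u l] normal when a non-trivial [b] is put in front of [u]. *)
Definition block_tail (u : U) (l : seq (A * U)) :=
  [/\ R u, u = 1 -> l = [::] & normal_tail l].

Lemma block_normal w b u l : block_tail u l -> normal_tail (block w b u l).2.
Proof. by case=> Ru u1 nl; rewrite /block; case: eqP => //=; split. Qed.

Lemma blockM v w b u l :
  (v * (block w b u l).1, (block w b u l).2) = block (v * w) b u l.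
Proof. by rewrite /block; case: ifP => //=; rewrite mulgA. Qed.

(** If the representative of [u] is 1 and [l] is non-empty, then [u] lies in [O] and [b] is the
    first letter of [l]. Otherwise [b = 1], and [u] splits into its [O]-part and its
    representative. *)
Lemma blockP u l : normal_tail l ->
  exists w b v l', [/\ O w, block_tail v l' & (u, l) = block w b v l'].
Proof.
move=> nl; have [Rr Ow] := coset_repP u; set r := coset_rep u in Rr Ow.
have [[r1 lN]|rl] := pselect (r = 1 /\ l <> [::]); last first.
  exists (u * r^-1), 1, r, l; rewrite /block eqxx mulgVK; split=> //.
  by split=> // r1; apply: contrapT => lN; exact: rl.
rewrite r1 invg1 mulg1 in Ow.
case: l nl lN => // -[b v] l [bN Rv vl nl] _.
by exists u, b, v, l; rewrite /block; case: eqP.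
Qed.

Variable alpha : A -> U -> U.
Hypotheses (alpha1 : alpha 1 =1 id)
  (alphaM : forall a b w, alpha (a * b) w = alpha a (alpha b w))
  (alphaO : forall a w, O w -> O (alpha a w))
  (alpha_mul : forall a v w, O v -> O w -> alpha a (v * w) = alpha a v * alpha a w).

(* Writing [u = w r] with [w] in [O] and [r] in [R], [a u = alpha a w * (a r)];
   if [r = 1], [a] merges with the first letter of the tail. *)
Definition act (a : A) (sigma : U * seq (A * U)) :=
  let r := coset_rep sigma.1 in
  let w := alpha a (sigma.1 * r^-1) in
  if sigma.2 is (b, u) :: l then
    if r == 1 then block w (a * b) u l else block w a r sigma.2
  else block w a r [::].

(** Allowing a trivial [b] unites the merging and non-merging cases of [act]: on blocks it is
    [alpha a] on the [O]-part and left multiplication by [a] on the letter. The action laws then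
    follow from those of [alpha] and of [A]. *)
Lemma act_block a w b u l : O w -> block_tail u l ->
  act a (block w b u l) = block (alpha a w) (a * b) u l.
Proof.
move=> Ow [Ru ul _]; rewrite {1}/block; case: eqP => [->|_]; rewrite /act /=.
  rewrite coset_repM // mulgK mulg1.
  (* For [b = 1], a non-empty [l] forces [u <> 1], so [a] does not merge with the next letter. *)
  by case: l ul => // -[c v] l ul; case: eqP => // /ul.
by rewrite -[w in coset_rep w]mulg1 coset_repM // invg1 mulg1 eqxx.
Qed.

Let N := [set sigma : U * seq (A * U) | normal_tail sigma.2].
Let X : Type := set_type N.

Lemma block_ind (P : X -> Prop) :
  (forall w b u l (n : N (block w b u l)), O w -> block_tail u l ->
     P (SigSub (mem_set n))) ->
  forall x, P x.
Proof.
move=> HP [[u l] /[dup] /set_mem /= nl m].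
have [w [b [v [l' [Ow vl E]]]]] := blockP u nl.
have n : N (block w b v l') by exact: block_normal.
suff -> : exist _ (u, l) m = SigSub (mem_set n) :> X by exact: HP.
exact: val_inj.
Qed.

Lemma bijections_of_normal_forms : exists (f : U -> bijection X) (g : A -> bijection X),
  [/\ {morph f : x y / x * y}, {morph g : x y / x * y},
  forall u x, \val (bij_fun (f u) x) = (u * (\val x).1, (\val x).2),
  forall a x, \val (bij_fun (g a) x) = act a (\val x) &
  forall a w, O w -> g a * f w = f (alpha a w) * g a].
Proof.
have O_mul v w : O v -> O w -> O (v * w) by case: sO => _ + _; exact.
have nU (u : U) (x : X) : N (u * (\val x).1, (\val x).2).
  by exact: set_mem (valP x).
pose actU u x : X := SigSub (mem_set (nU u x)).
have [||f fM fE] := @action_morphism U X actU.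
- by move=> x; apply: val_inj; rewrite /= mul1g -surjective_pairing.
- by move=> u v x; apply: val_inj; rewrite /= mulgA.
have nA (a : A) (x : X) : N (act a (\val x)).
  move: x; apply: block_ind => w b u l n Ow ul /=.
  by rewrite act_block //; exact: block_normal.
pose actA a x : X := SigSub (mem_set (nA a x)).
have [||g gM gE] := @action_morphism A X actA.
- move=> x; apply: val_inj => /=; move: x; apply: block_ind => w b u l n Ow ul /=.
  by rewrite act_block // mul1g alpha1.
- move=> a b x; apply: val_inj => /=; move: x; apply: block_ind => w c u l n Ow ul /=.
  by rewrite !act_block ?alphaM ?mulgA //; exact: alphaO.
exists f, g; split=> // [u x|a x|a w Ow]; rewrite ?fE ?gE //.
(* Both sides send the block of [v], [b], [u], [l] to that of [alpha a (w * v)], [a * b], [u], [l];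
   multiplicativity of [alpha a] on [O] identifies the two expressions. *)
apply: bijection_eq; apply: block_ind => v b u l n Ov ul; apply: val_inj.
rewrite /= !gE !fE /= blockM !act_block //; last exact: O_mul.
by rewrite blockM alpha_mul.
Qed.

End NormalForms.

(** * Evaluation of normal sequences in [hraag] *)

Section NormalSequences.
Local Open Scope group_scope.
Context {S : finType} (E : rel S) {U : groupType} (R : set U).

Lemma normal_sequencesE (sigma : U * seq (raag E * U)) :
  normal_sequences E R sigma <-> normal_tail R sigma.2.
Proof.
case: sigma => v l; rewrite /normal_sequences /=.
elim: l => [|[a u] l IHl] /=; first by split.
split=> [nl|[a1 Ru ul /IHl nl] [|i]] /=; last exact: nl.
  have [a1 Ru u1] := nl 0 erefl; split=> //.
  - by case: l u1 {IHl nl} => // p l /(_ erefl) u1 /u1.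
  - by apply/IHl => i; exact: (nl i.+1).
by move=> _; split=> // + /ul l0; rewrite l0.
Qed.

Context (O : set U) (phi : U -> U).

Lemma sequence_value_block w b u l :
  sequence_value E O phi (block w b u l) =
  hraag_base E O phi w * hraag_raag O phi b *
  sequence_value E O phi (u, l).
Proof.
rewrite /block; case: eqP => [->|_]; rewrite /sequence_value /=.
  by rewrite !gmulfM gmulf1 mulg1 !mulgA.
by rewrite big_cons /= !mulgA.
Qed.

(** For a generator this is the conjugation relator of [hnn]. Quantifying over all [w] in [O] makes
    the good elements a subgroup: for products and inverses the relation is used at a translate of
    [w] under [alpha]. *)
Lemma hraag_intertwine (alpha : raag E -> U -> U) :
  (alpha 1 =1 id) -> (forall a b w, alpha (a * b) w = alpha a (alpha b w)) ->
  (forall s w, O w -> alpha (relq_proj _ (fg_gen s)) w = phi w) ->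
  (forall a w, O w -> O (alpha a w)) ->
  forall a w, O w -> hraag_raag O phi a * hraag_base E O phi w =
                     hraag_base E O phi (alpha a w) * hraag_raag O phi a.
Proof.
move=> alpha1 alphaM alphaE alphaO.
pose good : set (raag E) := [set a | forall w, O w ->
  hraag_raag O phi a * hraag_base E O phi w =
  hraag_base E O phi (alpha a w) * hraag_raag O phi a].
suff : forall a, good a by [].
apply: raag_gen => [|s w Ow]; last first.
  rewrite alphaE // hraag_raagE.
  have : relq_proj (@hnn_relators U S O phi) (fprodr (fg_gen s) * fprodl w *
      (fprodr (fg_gen s))^-1 * (fprodl (phi w))^-1) = 1.
    by apply: relq_relator; exists s => //; exists w.
  move=> /(congr1 (relq_proj (@hraag_relators U S E O phi))).
  rewrite !gmulfM !gmulfV gmulf1 => /divg1_eq /=.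
  by move/(canRL (mulgVK _)).
split=> [w Ow|a b ga gb w Ow|a ga w Ow].
- by rewrite alpha1 gmulf1 mul1g mulg1.
- by rewrite gmulfM /= -mulgA gb // mulgA ga ?alphaM ?mulgA //; exact: alphaO.
- have := ga _ (alphaO a^-1 w Ow); rewrite -alphaM mulgV alpha1 /= => H.
  by rewrite gmulfV; apply/(canLR (mulKg _)); rewrite mulgA H mulgK.
Qed.

End NormalSequences.

(** * Bijectivity of evaluation, from the action on normal sequences *)

Theorem theorem4p8 (S : finType) (E : rel S) (hE : simple_graph E)
  (hS : 0 < #|S|)
  (U : topologicalGroupType) (hU : hausdorff_space U)
  (O : set U) (hO : subgroup O) (openO : open O)
  (phi : U -> U) (hphi : continuous_open_monomorphism O phi)
  (phiO : phi @` O = O)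
  (R : set U) (hR : right_coset_representatives O R) (R1 : R 1%g) :
  set_bij (normal_sequences E R) [set: hraag E O phi]
    (sequence_value E O phi).
Proof.
case: hphi => phiM phi_inj _ _.
have [alpha [[alpha1 alphaM] alphaE alphaO alpha_mul]] :=
  twisting E hO phiM phi_inj phiO.
have [f [g [fM gM fE gE fg]]] :=
  bijections_of_normal_forms hO hR R1 alpha1 alphaM alphaO alpha_mul.
have [|rho [rhoM rhoU rhoA]] := @hraag_lift _ E _ O phi _ f g fM gM.
  by move=> s w Ow; rewrite fg // alphaE.
pose start : set_type [set sigma : U * seq (raag E * U) | normal_tail R sigma.2] :=
  SigSub (mem_set (I : [set sigma | normal_tail R sigma.2] (1%g, [::]))).
(* Acting on the trivial sequence by the value of a normal sequence rebuilds that sequence, from its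
   last pair to its first. *)
have rhoK u l : normal_tail R l ->
    \val (bij_fun (rho (sequence_value E O phi (u, l))) start) = (u, l).
  rewrite /sequence_value /= rhoM rhoU /= fE.
  elim: l u => [|[a v] l IHl] u; first by rewrite big_nil (morph_one rhoM) /= mulg1.
  move=> [a1 Rv vl nl]; rewrite big_cons !rhoM rhoU rhoA /= gE fE IHl //.
  (* Seen as a block with trivial [O]-part and trivial letter, [(v, l)] is sent by [a] to
     [block 1 a v l], and [a <> 1] prevents any collapse. *)
  have -> : (v, l) = block 1%g 1%g v l by rewrite /block eqxx mul1g.
  have [O1 _ _] := hO.
  have alpha_one : alpha a 1%g = 1%g.
    by apply: (@mulgI _ (alpha a 1%g)); rewrite -alpha_mul // !mulg1.
  rewrite act_block; [|exact: hO|exact: hR|exact: R1|by []|by split].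
  by rewrite alpha_one mulg1 /block; case: eqP => //= _; rewrite mulg1.
(* Evaluation is equivariant; since the trivial sequence has value 1, this gives surjectivity. *)
have value_rho x sigma :
    sequence_value E O phi (\val (bij_fun (rho x) sigma)) =
    (x * sequence_value E O phi (\val sigma))%g.
  move: x sigma.
  pose good : set (hraag E O phi) := [set x | forall sigma,
    sequence_value E O phi (\val (bij_fun (rho x) sigma)) =
    (x * sequence_value E O phi (\val sigma))%g].
  suff : forall x, good x by [].
  apply: hraag_gen => [|u sigma|a sigma].
  - split=> [sigma|x y gx gy sigma|x gx sigma].
    + by rewrite (morph_one rhoM) mul1g.
    + by rewrite rhoM /= gx gy mulgA.
    + by rewrite -[in RHS](bij_invK (rho x) sigma) gx mulKg (morph_inv rhoM).
  - by rewrite rhoU fE /sequence_value /= gmulfM mulgA.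
  (* On blocks, the claim reduces to moving [a] past [w] in [hraag]. *)
  - elim/(@block_ind (raag E) _ _ _ hO hR): sigma => w b u l n Ow ul.
    rewrite rhoA gE /= act_block // !sequence_value_block.
    rewrite gmulfM !mulgA; congr (_ * _ * _)%g.
    by rewrite (hraag_intertwine alpha1 alphaM alphaE alphaO).
split=> //.
(* Injectivity: by [rhoK], a normal sequence is recovered from its value. *)
- move=> [u l] [v m] /set_mem/normal_sequencesE /= nl.
  move=> /set_mem/normal_sequencesE /= nm Elm.
  by rewrite -(rhoK u l) // -(rhoK v m) // Elm.
- move=> x _; exists (\val (bij_fun (rho x) start)).
    by apply/normal_sequencesE; exact: set_mem (valP (bij_fun (rho x) start)).
  by rewrite value_rho /sequence_value /= gmulf1 big_nil !mulg1.
Qed.
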